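(* Let $\kappa$ be an infinite cardinal and let $(B_n)_{n\in\mathbb{N}}$ be a sequence of branches in $\Gamma=\{0,1\}^\kappa$ such that $B_n\ne B_m$ for $n\ne m$. Then the sequence of functionals $(B_n^\ast)_{n\in\mathbb{N}}$ in $X_\kappa^\ast$ contains a subsequence equivalent to the usual $\ell_1$-basis.
   Context: Let $\kappa$ be an infinite cardinal. The tree is $\mathcal{D}=\{0,1\}^{<\kappa}=\bigcup_{\eta<\kappa}\{0,1\}^\eta$ ($\eta$ ranging over ordinals); its elements are called nodes; $s\in\{0,1\}^\eta$ has level $lev(s)=\eta$; $\mathcal{D}$ is ordered by the initial segment order $\le$ ($s\le s'$ iff $s'$ extends $s$ as a function). Elements of $\Gamma=\{0,1\}^\kappa$ are called branches; a branch $B=(a_\xi)_{\xi<\kappa}$ is identified with the set of nodes $\{(a_\xi)_{\xi<\eta}:\eta<\kappa\}$. A segment is a linearly ordered subset $\mathcal{I}\subseteq\mathcal{D}$ such that $s<t<s'$ with $s,s'\in\mathcal{I}$ implies $t\in\mathcal{I}$. For a non-empty segment $\mathcal{I}$, let $\eta_1$ be the least level of a node of $\mathcal{I}$; if there is an ordinal $\eta$ and a node $s'$ of level $\eta$ with $s\le s'$ for all $s\in\mathcal{I}$, let $\eta_2$ be the least such $\eta$, and call $\mathcal{I}$ an $\eta_1$-$\eta_2$ segment. A finite family $\{\mathcal{I}_j\}_{j=1}^r$ of segments is admissible if the $\mathcal{I}_j$ are pairwise disjoint and there are ordinals $\eta_1<\eta_2$ such that every $\mathcal{I}_j$ is an $\eta_1$-$\eta_2$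 segment. Let $c_{00}(\mathcal{D})$ be the space of finitely supported functions $x:\mathcal{D}\to\mathbb{R}$, and for a segment $\mathcal{I}$ put $\mathcal{I}^\ast(x)=\sum_{s\in\mathcal{I}}x(s)$. The space $X_\kappa$ is the completion of $c_{00}(\mathcal{D})$ under the norm $\|x\|=\sup\big(\sum_{j=1}^r|\mathcal{I}_j^\ast(x)|^2\big)^{1/2}$, the supremum being over all finite admissible families $\{\mathcal{I}_j\}_{j=1}^r$. For a branch $B$, $B^\ast\in X_\kappa^\ast$ is the continuous extension to $X_\kappa$ of the (bounded) functional $x\mapsto\sum_{s\in B}x(s)$ on $c_{00}(\mathcal{D})$. A sequence $(f_n)$ in a Banach space is equivalent to the usual $\ell_1$-basis if there are $C_1,C_2>0$ with $C_1\sum_{i=1}^n|a_i|\le\|\sum_{i=1}^n a_if_i\|\le C_2\sum_{i=1}^n|a_i|$ for all $n$ and all scalars $a_1,\dots,a_n$. *)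

(* Defs.v *)
From HB Require Import structures.
From mathcomp Require Import all_boot all_order all_algebra.
From mathcomp Require Import all_classical all_reals topology normedtype.
From mathcomp Require Import ring.
From mathcomp Require wochoice.

Set Implicit Arguments.
Unset Strict Implicit.
Unset Printing Implicit Defensive.

Import Order.TTheory GRing.Theory Num.Theory.
Import numFieldNormedType.Exports.

Local Open Scope classical_set_scope.
Local Open Scope ring_scope.

(* An infinite cardinal is an infinite initial ordinal: a well-ordered type
   that injects into none of its proper initial segments.  The elements of
   [kappa] are then exactly the ordinals below the cardinal. *)
Record infinite_cardinal := InfiniteCardinal {
  cardinal_display : Order.disp_t;
  cardinal_sort :> orderType cardinal_display;
  cardinal_wo : wochoice.well_order (fun x y : cardinal_sort => (x <= y)%O);
  cardinal_infinite : infinite_set [set: cardinal_sort];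
  cardinal_initial : forall a : cardinal_sort,
    ~~ ([set: cardinal_sort] #<= [set x : cardinal_sort | (x < a)%O])%card
}.

Section dyadic_tree.
Variable kappa : infinite_cardinal.

Record node := Node {
  lev : kappa;
  bit : {xi : kappa | (xi < lev)%O} -> bool
}.

HB.instance Definition _ := gen_eqMixin node.
HB.instance Definition _ := gen_choiceMixin node.

Definition node_le (s t : node) : Prop :=
  (lev s <= lev t)%O /\
  forall xi (hs : (xi < lev s)%O) (ht : (xi < lev t)%O),
    bit (exist _ xi hs) = bit (exist _ xi ht).

Definition node_lt (s t : node) : Prop := node_le s t /\ s <> t.

Definition branch := kappa -> bool.

Definition branch_node (B : branch) (eta : kappa) : node :=
  @Node eta (fun xi => B (sval xi)).

Definition branch_nodes (B : branch) : set node := range (branch_node B).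

Definition segment (I : set node) : Prop :=
  (forall s t, I s -> I t -> node_le s t \/ node_le t s) /\
  (forall s t s', I s -> I s' -> node_lt s t -> node_lt t s' -> I t).

Definition bounded_at_level (I : set node) (eta : kappa) : Prop :=
  exists s', lev s' = eta /\ forall s, I s -> node_le s s'.

Definition least (A : set kappa) (eta : kappa) : Prop := A eta /\ lbound A eta.

Definition segment_between (eta1 eta2 : kappa) (I : set node) : Prop :=
  [/\ segment I, I !=set0, least (lev @` I) eta1 &
      least (bounded_at_level I) eta2].

(* The strict inequality rules out one-node segments; every node still lies in a
   two-node segment, which is enough for the norm below to be definite. *)
Definition admissible (r : nat) (I : 'I_r -> set node) : Prop :=
  trivIset setT I /\
  exists eta1 eta2 : kappa,
    (eta1 < eta2)%O /\ forall j, segment_between eta1 eta2 (I j).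

End dyadic_tree.

Section c00.
Variables (kappa : infinite_cardinal) (R : realType).

Definition finitely_supported : {pred node kappa -> R^o} :=
  mem [set x : node kappa -> R^o | finite_set [set s | x s != 0]].

Record c00 := C00 {
  c00_val :> node kappa -> R^o;
  c00P : c00_val \in finitely_supported
}.

HB.instance Definition _ := [isSub for c00_val].
HB.instance Definition _ := [Choice of c00 by <:].

Lemma finitely_supported_submod : submod_closed finitely_supported.
Proof.
split.
  rewrite inE /=; apply: (sub_finite_set _ (finite_set0 (node kappa))) => s /=.
  by rewrite eqxx.
move=> a x y; rewrite !inE /= => fx fy.
have fxy : finite_set ([set s | x s != 0] `|` [set s | y s != 0]).
  by rewrite finite_setU.
apply: (sub_finite_set _ fxy) => s /= h.
have [x0|] := eqVneq (x s) 0; last by left.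
have [y0|] := eqVneq (y s) 0; last by right.
by move: h; rewrite /GRing.add /GRing.scale /= x0 y0 scaler0 addr0 eqxx.
Qed.

HB.instance Definition _ :=
  GRing.isSubmodClosed.Build _ _ finitely_supported finitely_supported_submod.
HB.instance Definition _ := [SubChoice_isSubLmodule of c00 by <:].

Definition node_sum (I : set (node kappa)) (x : c00) : R :=
  \sum_(s \in I) (x s : R).

Definition family_norms (x : c00) : set R :=
  [set y | exists r (I : 'I_r -> set (node kappa)), admissible I /\
    y = Num.sqrt (\sum_(j < r) `|node_sum (I j) x| ^+ 2)].

Definition tree_norm (x : c00) : R := sup (family_norms x).

End c00.

Section cardinal_facts.
Variable kappa : infinite_cardinal.

Lemma least_exists (A : set kappa) : A !=set0 -> exists eta, least A eta.
Proof.
move=> [a Aa]; have [|eta [[etaA lb] _]] := @cardinal_wo kappa (mem A).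
  by exists a; rewrite inE.
exists eta; split; first by rewrite inE in etaA.
by move=> b Ab; apply: lb; rewrite inE.
Qed.

Lemma cardinal_unbounded (a : kappa) : exists b : kappa, (a < b)%O.
Proof.
apply: contrapT => /forallNP amax.
have le_a b : (b <= a)%O by rewrite leNgt; apply/negP/amax.
have : infinite_set ([set: kappa] `\` [set a]).
  exact: infinite_setD (@cardinal_infinite kappa) (finite_set1 a).
move=> /infiniteP /card_leP/unsquash g0.
pose g (n : nat) : kappa := sval (g0 (exist _ n (mem_set Logic.I))).
have gI m n : g m = g n -> m = n.
  move=> /val_inj e.
  have := @inj _ _ _ g0 _ _ (in_setT _) (in_setT _) e.
  by move=> /(congr1 sval).
have gNa n : g n != a.
  rewrite /g; case: (g0 _) => y /= /set_mem [_] /eqP; exact.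
pose f x := if x == a then g 0 else
  if pselect (exists n, x = g n) is left e then g (projT1 (cid e)).+1 else x.
have fNa x : f x != a.
  rewrite /f; have [_|xa] := eqVneq x a; first exact: gNa.
  by case: pselect => [e|_]; [exact: gNa|exact: xa].
have fg n : f (g n) = g n.+1.
  rewrite /f (negbTE (gNa n)); case: pselect => [e|]; last by case; exists n.
  by case: cid => m /= /gI ->.
have fa : f a = g 0 by rewrite /f eqxx.
have fid x : x != a -> ~ (exists n, x = g n) -> f x = x.
  by rewrite /f => /negbTE ->; case: pselect.
have finj : injective f.
  move=> x y.
  have [->|xa] := eqVneq x a; have [->|ya] := eqVneq y a => //; rewrite ?fa.
  - have [[n ->]|nn] := pselect (exists n, y = g n).
      by rewrite fg => /gI.
    by rewrite fid// => e; case: nn; exists 0%N.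
  - have [[n ->]|nn] := pselect (exists n, x = g n).
      by rewrite fg => /gI.
    by rewrite fid// => e; case: nn; exists 0%N.
  have [[n ->]|nn] := pselect (exists n, x = g n);
  have [[m ->]|mm] := pselect (exists n, y = g n); rewrite ?fg ?fid//.
  - by move=> /gI [->].
  - by move=> e; case: mm; exists n.+1.
  - by move=> e; case: nn; exists m.+1.
have /negP := @cardinal_initial kappa a; apply.
have -> : [set x : kappa | (x < a)%O] = [set x | x != a].
  by apply/seteqP; split => x /=; rewrite lt_neqAle le_a andbT.
rewrite -(card_le_eql (inj_card_eq (f := f) (A := setT) _)); last first.
  by move=> x y _ _; exact: finj.
by apply: subset_card_le => _ [x _ <-]; exact: fNa.
Qed.

Lemma cardinal_min : exists a : kappa, forall b, (a <= b)%O.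
Proof.
have [|a [_ alb]] := @least_exists setT; last by exists a => b; exact: alb.
exact: infinite_setN0 (@cardinal_infinite kappa).
Qed.

End cardinal_facts.

Section tree_facts.
Variable kappa : infinite_cardinal.
Implicit Types s t : node kappa.

Lemma node_le_refl s : node_le s s.
Proof. by split => // xi h1 h2; congr bit; congr exist; exact: bool_irrelevance. Qed.

Lemma node_le_anti s t : node_le s t -> node_le t s -> s = t.
Proof.
case: s => n f; case: t => m g [/= nm fg] [/= mn _].
have e : n = m by apply/eqP; rewrite eq_le nm mn.
subst m; congr Node; apply/funext => -[xi h]; exact: fg.
Qed.

Lemma node_le_restr s t u : node_le s u -> node_le t u -> (lev s <= lev t)%O ->
  node_le s t.
Proof.
move=> [su hsu] [tu htu] st; split => // xi h1 h2.
by rewrite (hsu xi h1 (lt_le_trans h1 su)) (htu xi h2 (lt_le_trans h1 su)).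
Qed.

Lemma node_lt_lev s t : node_lt s t -> (lev s < lev t)%O.
Proof.
case=> [[st h] ne]; rewrite lt_neqAle st andbT; apply/eqP => e; apply: ne.
apply: node_le_anti => //; split; first by rewrite e.
by move=> xi h1 h2; rewrite (h xi h2 h1).
Qed.

Lemma branch_node_le (B : branch kappa) a b : (a <= b)%O ->
  node_le (branch_node B a) (branch_node B b).
Proof. by split. Qed.

Lemma branch_segment (B : branch kappa) (eta1 eta2 : kappa) : (eta1 <= eta2)%O ->
  segment_between eta1 eta2
    (branch_node B @` [set xi | (eta1 <= xi)%O && (xi <= eta2)%O]).
Proof.
move=> e12; split.
- split.
    move=> _ _ [a _ <-] [b _ <-]; have /orP[ab|ba] := le_total a b.
      by left; exact: branch_node_le.
    by right; exact: branch_node_le.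
  move=> _ t _ [a /= /andP[e1a ae2] <-] [b /= /andP[e1b be2] <-] at_ tb.
  have /= la := node_lt_lev at_; have /= lb := node_lt_lev tb.
  exists (lev t); first by rewrite /= (le_trans e1a (ltW la)) (le_trans (ltW lb)).
  apply: node_le_anti; apply: (@node_le_restr _ _ (branch_node B b)) => //=.
  + exact/branch_node_le/ltW.
  + by case: tb.
  + by case: tb.
  + exact/branch_node_le/ltW.
- by exists (branch_node B eta1); exists eta1 => //=; rewrite lexx.
- split; first by exists (branch_node B eta1) => //; exists eta1 => //=; rewrite lexx.
  by move=> _ [_ [a /= /andP[ea _] <-] <-].
- split.
    exists (branch_node B eta2); split => // _ [a /= /andP[_ ae] <-].
    exact: branch_node_le.
  move=> eta [s' [<- h]].
  have [] := h (branch_node B eta2) _ => //.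
  by exists eta2 => //=; rewrite lexx andbT.
Qed.

End tree_facts.

Section l2_norm.
Variables (R : realType) (r : nat).
Implicit Types u v : 'I_r -> R.

Lemma cauchy_schwarz_sum u v :
  (\sum_i u i * v i) ^+ 2 <= (\sum_i u i ^+ 2) * (\sum_i v i ^+ 2).
Proof.
have : 0 <= \sum_i \sum_j (u i * v j - u j * v i) ^+ 2.
  by apply: sumr_ge0 => i _; apply: sumr_ge0 => j _; exact: sqr_ge0.
suff -> : \sum_i \sum_j (u i * v j - u j * v i) ^+ 2 =
    ((\sum_i u i ^+ 2) * (\sum_i v i ^+ 2) - (\sum_i u i * v i) ^+ 2) *+ 2.
  by rewrite pmulrn_lge0// subr_ge0.
have e i j : (u i * v j - u j * v i) ^+ 2 =
    u i ^+ 2 * v j ^+ 2 + v i ^+ 2 * u j ^+ 2 - (u i * v i) * (u j * v j) *+ 2.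
  by ring.
under eq_bigr do under eq_bigr do rewrite e.
have d (f g : 'I_r -> R) : \sum_i \sum_j f i * g j = (\sum_i f i) * (\sum_i g i).
  by rewrite mulr_suml; apply: eq_bigr => i _; rewrite mulr_sumr.
under eq_bigr do rewrite sumrB big_split/= sumrMnl.
rewrite sumrB big_split/= sumrMnl.
by rewrite !d expr2; ring.
Qed.

Lemma l2_norm_triangle u v :
  Num.sqrt (\sum_i (u i + v i) ^+ 2) <=
  Num.sqrt (\sum_i u i ^+ 2) + Num.sqrt (\sum_i v i ^+ 2).
Proof.
have sq_ge0 w : 0 <= \sum_(i < r) (w i : R) ^+ 2.
  by apply: sumr_ge0 => i _; exact: sqr_ge0.
rewrite -[leRHS]ger0_norm ?addr_ge0 ?sqrtr_ge0// -sqrtr_sqr ler_wsqrtr//.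
rewrite sqrrD !sqr_sqrtr//.
under eq_bigr do rewrite sqrrD.
rewrite !big_split/= lerD2r lerD2l -mulr2n lerMn2r/=.
apply: (le_trans (ler_norm _)).
by rewrite -sqrtrM// -sqrtr_sqr ler_wsqrtr// cauchy_schwarz_sum.
Qed.

End l2_norm.

Section tree_norm_facts.
Variables (kappa : infinite_cardinal) (R : realType).
Implicit Types (x y : c00 kappa R) (I : set (node kappa)).

Lemma c00_support x : exists r : seq (node kappa),
  uniq r /\ forall s, (x s != 0) = (s \in r).
Proof.
have fx : finite_set [set s | x s != 0] by have := c00P x; rewrite inE.
have /finite_seqP[r rE] := fx; exists (undup r); split; first exact: undup_uniq.
move=> s; rewrite mem_undup.
have /= e : [set s | x s != 0] s = [set` r] s by rewrite rE.
by apply/idP/idP; rewrite e.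
Qed.

Lemma node_sumE I x (r : seq (node kappa)) : uniq r ->
  (forall s, s \notin r -> x s = 0) ->
  node_sum I x = \sum_(s <- r | s \in I) x s.
Proof.
move=> ur x0; rewrite /node_sum [RHS]bigfs//; last by move=> s _; exact: x0.
by rewrite set_mem_set.
Qed.

Lemma node_sum_linear I : linear (node_sum I : c00 kappa R -> R^o).
Proof.
move=> a x y; have [r [_ hr]] := c00_support x; have [q [_ hq]] := c00_support y.
have xr s : s \notin undup (r ++ q) -> x s = 0.
  by rewrite mem_undup mem_cat negb_or -hr => /andP[/negPn/eqP].
have yr s : s \notin undup (r ++ q) -> y s = 0.
  by rewrite mem_undup mem_cat negb_or -hq => /andP[_ /negPn/eqP].
have xyr s : s \notin undup (r ++ q) -> (a *: x + y) s = 0.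
  by move=> h; rewrite -[LHS]/(a * x s + y s) xr// yr// mulr0 addr0.
rewrite !(@node_sumE I _ (undup (r ++ q)))// ?undup_uniq//.
by rewrite scaler_sumr -big_split.
Qed.

Lemma node_sumD I x y : node_sum I (x + y) = node_sum I x + node_sum I y.
Proof. by have := node_sum_linear I 1 x y; rewrite !scale1r. Qed.

Lemma node_sumZ I a x : node_sum I (a *: x) = a * node_sum I x.
Proof.
have := node_sum_linear I a x 0; rewrite addr0 => ->.
rewrite -[RHS]addr0; congr (_ + _).
have := node_sum_linear I 1 0 0; rewrite !scale1r addr0 => /eqP.
by rewrite -subr_eq0 opprD addrA subrr sub0r oppr_eq0 => /eqP.
Qed.

Lemma family_norms_nonempty x : family_norms x !=set0.
Proof.
have [a _] := cardinal_min kappa; have [b ab] := cardinal_unbounded a.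
exists 0, 0%N, (fun=> set0); split; last by rewrite big_ord0 sqrtr0.
by split; [move=> []|exists a, b; split => // -[]].
Qed.

Lemma family_norms_bounded x : has_ubound (family_norms x).
Proof.
have [q [uq hq]] := c00_support x.
have x0 s : s \notin q -> x s = 0 by rewrite -hq => /negPn/eqP.
exists (\sum_(s <- q) `|x s : R|) => _ [r [I [[tI _] ->]]].
rewrite -[leRHS]ger0_norm ?sumr_ge0// -sqrtr_sqr ler_wsqrtr//.
apply: (@le_trans _ _ ((\sum_(j < r) `|node_sum (I j) x|) ^+ 2)).
  rewrite expr2 mulr_suml ler_sum// => j _; rewrite expr2 ler_wpM2l//.
  by rewrite (bigD1 j)//= lerDl sumr_ge0.
rewrite lerXn2r ?nnegrE ?sumr_ge0//.
apply: (@le_trans _ _ (\sum_(j < r) \sum_(s <- q | s \in I j) `|x s : R|)).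
  by rewrite ler_sum// => j _; rewrite (node_sumE _ uq x0) ler_norm_sum.
under eq_bigr do rewrite big_mkcond.
rewrite exchange_big/= ler_sum// => s _.
have [[j sj]|nj] := pselect (exists j, s \in I j).
  rewrite (bigD1 j)//= sj big1 ?addr0// => i ij; case: ifPn => // si.
  suff e : i = j by rewrite e eqxx in ij.
  by apply: tI => //; exists s; split; exact: set_mem.
rewrite big1// => j _; case: ifPn => // sj; case: nj; by exists j.
Qed.

Lemma tree_norm_ge r (I : 'I_r -> set (node kappa)) x : admissible I ->
  Num.sqrt (\sum_(j < r) `|node_sum (I j) x| ^+ 2) <= tree_norm x.
Proof.
by move=> aI; apply: (ub_le_sup (family_norms_bounded x)); exists r, I.
Qed.

Lemma tree_norm_le x c :
  (forall r (I : 'I_r -> set (node kappa)), admissible I ->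
    Num.sqrt (\sum_(j < r) `|node_sum (I j) x| ^+ 2) <= c) -> tree_norm x <= c.
Proof.
move=> h; apply: ge_sup; first exact: family_norms_nonempty.
by move=> _ [r [I [aI ->]]]; exact: h.
Qed.

Lemma node_sum_le_norm I x eta1 eta2 : (eta1 < eta2)%O ->
  segment_between eta1 eta2 I -> `|node_sum I x| <= tree_norm x.
Proof.
move=> e12 sI; have := @tree_norm_ge 1 (fun=> I) x.
rewrite big_ord1 sqrtr_sqr normr_id; apply.
split; last by exists eta1, eta2.
by move=> i j _ _ _; rewrite !ord1.
Qed.

Lemma tree_normD x y : tree_norm (x + y) <= tree_norm x + tree_norm y.
Proof.
apply: tree_norm_le => r I aI.
apply: le_trans (lerD (tree_norm_ge x aI) (tree_norm_ge y aI)).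
under eq_bigr do rewrite node_sumD real_normK ?num_real//.
under [in X in _ <= X + _]eq_bigr do rewrite real_normK ?num_real//.
under [in X in _ <= _ + X]eq_bigr do rewrite real_normK ?num_real//.
exact: l2_norm_triangle.
Qed.

Lemma tree_normZ a x : tree_norm (a *: x) = `|a| * tree_norm x.
Proof.
have le b y : tree_norm (b *: y) <= `|b| * tree_norm y.
  apply: tree_norm_le => r I aI.
  have := tree_norm_ge y aI; move=> /(ler_wpM2l (normr_ge0 b)); apply: le_trans.
  under eq_bigr do rewrite node_sumZ normrM exprMn.
  rewrite -mulr_sumr sqrtrM ?sqr_ge0// sqrtr_sqr normr_id//.
apply/le_anti; rewrite le/=.
have [->|a0] := eqVneq a 0.
  rewrite normr0 mul0r; apply: le_trans (@tree_norm_ge 0 (fun=> set0) _ _).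
    exact: sqrtr_ge0.
  have [a1 _] := cardinal_min kappa; have [b ab] := cardinal_unbounded a1.
  by split; [move=> []|exists a1, b; split => // -[]].
rewrite -ler_pdivlMl ?normr_gt0// -normfV.
by have := le a^-1 (a *: x); rewrite scalerA mulVf// scale1r.
Qed.

Lemma branch_sum_le_norm (B : branch kappa) x :
  `|node_sum (branch_nodes B) x| <= tree_norm x.
Proof.
have [q [uq hq]] := c00_support x.
have x0 s : s \notin q -> x s = 0 by rewrite -hq => /negPn/eqP.
have [a amin] := cardinal_min kappa; have [b ab] := cardinal_unbounded a.
have [c [bc cq]] : exists c, (b <= c)%O /\ forall s, s \in q -> (lev s <= c)%O.
  elim: q {uq hq x0} => [|s q [c [bc cq]]]; first by exists b.
  exists (Order.max c (lev s)); split; first by rewrite le_max bc.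
  move=> t; rewrite inE => /predU1P[->|/cq tc]; rewrite le_max ?lexx ?orbT//.
  by rewrite tc.
have := node_sum_le_norm x (lt_le_trans ab bc) (branch_segment B (amin c)).
rewrite !(node_sumE _ uq x0).
congr (`|_| <= _); rewrite big_seq_cond [RHS]big_seq_cond; apply: eq_bigl => s.
have [sq/=|//] := boolP (s \in q); apply/idP/idP; rewrite !inE.
  by move=> [e _ <-]; exists e.
move=> [e _ es]; exists e => //=; rewrite amin/=.
by have := cq s sq; rewrite -es.
Qed.

Lemma tree_norm_eq0 x : tree_norm x = 0 -> x = 0.
Proof.
move=> nx; apply/val_inj/funext => s /=; apply/eqP/negPn/negP => xs.
have [q [uq hq]] := c00_support x.
have [m [xm mmax]] : exists m, x m != 0 /\
    forall t, x t != 0 -> (lev t <= lev m)%O.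
  have : s \in q by rewrite -hq.
  suff : exists m, m \in q /\ forall t, t \in q -> (lev t <= lev m)%O.
    move=> [m [mq h]] _; exists m; rewrite hq; by split => // t; rewrite hq => /h.
  have : s \in q by rewrite -hq.
  elim: q s {uq hq xs} => // u q IH s _.
  case: q IH => [|v q] IH.
    by exists u; rewrite mem_head; split => // t; rewrite inE => /eqP ->.
  have [m [mq h]] := IH v (mem_head _ _).
  have [um|mu] := leP (lev u) (lev m).
    exists m; rewrite inE mq orbT; split => // t; rewrite inE => /predU1P[->//|].
    exact: h.
  exists u; rewrite mem_head; split => // t; rewrite inE => /predU1P[->//|/h].
  by move=> /le_trans; apply; exact: ltW.
have [b [lb bmin]] := @least_exists kappa [set b | (lev m < b)%O]
  (cardinal_unbounded (lev m)).
pose B : branch kappa := fun xi =>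
  if pselect (xi < lev m)%O is left h then bit (exist _ xi h) else false.
have Bm : branch_node B (lev m) = m.
  apply: node_le_anti; split => //= xi h1 h2; rewrite /B; case: pselect => // h3;
  by congr bit; congr exist; exact: bool_irrelevance.
have := node_sum_le_norm x lb (branch_segment B (ltW lb)).
have -> : node_sum (branch_node B @` [set xi | (lev m <= xi)%O && (xi <= b)%O]) x
    = x m.
  have x0 t : t \notin q -> x t = 0 by rewrite -hq => /negPn/eqP.
  rewrite (node_sumE _ uq x0) big_mkcond/= (bigD1_seq m)/= -?hq//.
  rewrite ifT; last by rewrite inE; exists (lev m) => //=; rewrite lexx ltW.
  rewrite big1_seq ?addr0// => t /andP[tm tq]; case: ifPn => //.
  rewrite inE => -[e /= /andP[me _] et].
  have /mmax : x t != 0 by rewrite hq.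
  rewrite -et/= => em; have e_ : e = lev m by apply/eqP; rewrite eq_le em.
  by move: tm; rewrite -et e_ Bm eqxx.
by rewrite nx normr_le0 (negbTE xm).
Qed.

HB.instance Definition _ := @Lmodule_isNormed.Build R (c00 kappa R)
  (@tree_norm kappa R) tree_normD tree_normZ tree_norm_eq0.

End tree_norm_facts.

Section dual_space.
Variables (R : realType) (V : normedModType R).

Definition continuous_functional : {pred V -> R^o} :=
  mem [set f : V -> R^o | linear f /\ continuous f].

Record dual := Dual {
  dual_val :> V -> R^o;
  dualP : dual_val \in continuous_functional
}.

HB.instance Definition _ := [isSub for dual_val].
HB.instance Definition _ := [Choice of dual by <:].

Lemma continuous_functional_submod : submod_closed continuous_functional.
Proof.
split.
  rewrite inE; split => [a x y|x]; last exact: (@cst_continuous V R^o 0).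
  by rewrite -[LHS]/0 -[RHS]/(a *: 0 + 0) scaler0 addr0.
move=> a f g; rewrite !inE => -[lf cf] [lg cg]; split.
  move=> b x y; rewrite -[LHS]/(a *: f (b *: x + y) + g (b *: x + y)).
  rewrite -[RHS]/(b *: (a *: f x + g x) + (a *: f y + g y)) lf lg.
  by rewrite !scalerDr !scalerA (mulrC a b) addrACA.
move=> x; apply: (@cvgD _ R^o); last exact: cg.
by apply: (@cvgZr _ R^o); exact: cf.
Qed.

HB.instance Definition _ :=
  GRing.isSubmodClosed.Build _ _ continuous_functional
    continuous_functional_submod.
HB.instance Definition _ := [SubChoice_isSubLmodule of dual by <:].

Lemma dual_linear (f : dual) : linear f.
Proof. by have := dualP f; rewrite inE => -[]. Qed.

Lemma dual_continuous (f : dual) : continuous f.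
Proof. by have := dualP f; rewrite inE => -[]. Qed.

HB.instance Definition _ (f : dual) :=
  GRing.isLinear.Build R V R^o *:%R f (dual_linear f).

Definition dual_norm (f : dual) : R :=
  sup [set `|f x : R| | x in [set x : V | `|x| <= 1]].

Lemma dual_norm_nonempty (f : dual) :
  [set `|f x : R| | x in [set x : V | `|x| <= 1]] !=set0.
Proof. by exists `|f 0 : R|; exists 0 => //=; rewrite normr0. Qed.

Lemma dual_norm_bounded (f : dual) :
  has_ubound [set `|f x : R| | x in [set x : V | `|x| <= 1]].
Proof.
have := @dual_continuous f 0 => /continuous_linear_bounded.
move=> /(_ 0)/linear_boundedP/pinfty_ex_gt0[M M0 hM].
exists M => _ [x /= x1 <-]; apply: (le_trans (hM x)).
by rewrite -[leRHS]mulr1 ler_wpM2l// ltW.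
Qed.

Lemma dual_norm_le (f : dual) c :
  (forall x, `|x| <= 1 -> `|f x : R| <= c) -> dual_norm f <= c.
Proof.
move=> h; apply: ge_sup; first exact: dual_norm_nonempty.
by move=> _ [x /= x1 <-]; exact: h.
Qed.

Lemma dual_norm_ge (f : dual) x : `|f x : R| <= dual_norm f * `|x|.
Proof.
have [->|x0] := eqVneq x 0; first by rewrite linear0 !normr0 mulr0.
have nx : 0 < `|x| by rewrite normr_gt0.
rewrite -ler_pdivrMr//; apply: (ub_le_sup (dual_norm_bounded f)).
exists (`|x|^-1 *: x) => /=.
  by rewrite normrZ normfV normr_id mulVf// gt_eqF.
by rewrite linearZ/= -[_ *: _]/(_ * _) normrM normfV normr_id mulrC.
Qed.

Lemma dual_norm_ge0 (f : dual) : 0 <= dual_norm f.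
Proof.
apply: (@le_trans _ _ `|f 0 : R|) => //.
by apply: (ub_le_sup (dual_norm_bounded f)); exists 0 => //=; rewrite normr0.
Qed.

Lemma dual_normD (f g : dual) : dual_norm (f + g) <= dual_norm f + dual_norm g.
Proof.
apply: dual_norm_le => x x1.
rewrite -[(f + g) x]/(f x + g x) (le_trans (ler_normD _ _))// lerD//.
  by apply: (ub_le_sup (dual_norm_bounded f)); exists x.
by apply: (ub_le_sup (dual_norm_bounded g)); exists x.
Qed.

Lemma dual_normZ a (f : dual) : dual_norm (a *: f) = `|a| * dual_norm f.
Proof.
have le b (g : dual) : dual_norm (b *: g) <= `|b| * dual_norm g.
  apply: dual_norm_le => x x1.
  rewrite -[(b *: g) x]/(b * g x) normrM ler_wpM2l//.
  by apply: (ub_le_sup (dual_norm_bounded g)); exists x.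
apply/le_anti; rewrite le/=.
have [->|a0] := eqVneq a 0; first by rewrite normr0 mul0r dual_norm_ge0.
rewrite -ler_pdivlMl ?normr_gt0// -normfV.
by have := le a^-1 (a *: f); rewrite scalerA mulVf// scale1r.
Qed.

Lemma dual_norm_eq0 (f : dual) : dual_norm f = 0 -> f = 0.
Proof.
move=> nf; apply/val_inj/funext => x; apply/eqP.
by have := dual_norm_ge f x; rewrite nf mul0r normr_le0.
Qed.

HB.instance Definition _ := @Lmodule_isNormed.Build R dual
  dual_norm dual_normD dual_normZ dual_norm_eq0.

End dual_space.

Definition l1_basis_equivalent (R : realType) (V : normedModType R)
    (f : nat -> V) : Prop :=
  exists C1 C2 : R, [/\ 0 < C1, 0 < C2 &
    forall (n : nat) (a : 'I_n -> R),
      C1 * (\sum_(i < n) `|a i|) <= `|\sum_(i < n) a i *: f i| /\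
      `|\sum_(i < n) a i *: f i| <= C2 * (\sum_(i < n) `|a i|)].

(* Any two completions of [V] are linearly isometric over [V], so a statement
   about all of them is a statement about the completion. *)
Record completion (R : realType) (V : normedModType R) := Completion {
  completion_space :> completeNormedModType R;
  completion_map : {linear V -> completion_space};
  completion_isometry : forall v, `|completion_map v| = `|v|;
  completion_dense : dense (range completion_map)
}.

Section extension.
Variables (R : realType) (V : normedModType R) (X : completion V).
Variables (g : V -> R) (M : R).
Hypothesis g_linear : linear (g : V -> R^o).
Hypothesis g_bounded : forall v, `|g v| <= M * `|v|.
Let iota := completion_map X.

Lemma bounded_functional_extends : exists h : dual X, forall v, h (iota v) = g v.
Proof.
have gB v w : g v - g w = g (v - w).
  by have := g_linear (-1) w v; rewrite !scaleN1r (addrC _ v) => ->; rewrite addrC.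
have [M' M'0 hM'] : exists2 M', 0 < M' & forall v, `|g v| <= M' * `|v|.
  exists (`|M| + 1) => [|v]; first by rewrite ltr_wpDl.
  apply: (le_trans (g_bounded v)); rewrite ler_wpM2r//.
  by rewrite (le_trans (ler_norm _))// lerDl.
pose E (x : X) := [set g v - M' * `|iota v - x| | v in [set: V]].
pose h x := sup (E x).
have gle v w : g v <= g w + M' * `|v - w|.
  by rewrite -lerBlDl gB (le_trans (ler_norm _)).
have key v x w : g w - M' * `|iota w - x| <= g v + M' * `|iota v - x|.
  rewrite lerBlDr (le_trans (gle w v))// -addrA lerD2l -mulrDr ler_pM2l//.
  rewrite -(completion_isometry X) linearB/= (le_trans (ler_distD x _ _))//.
  by rewrite addrC (distrC x).
have Eub x : has_ubound (E x).
  by exists (g 0 + M' * `|iota 0 - x|) => _ [w _ <-]; exact: key.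
have approx x v : `|h x - g v| <= M' * `|iota v - x|.
  rewrite ler_distl; apply/andP; split.
    by apply: (ub_le_sup (Eub x)); exists v.
  apply: ge_sup; first by exists (g 0 - M' * `|iota 0 - x|); exists 0.
  by move=> _ [w _ <-]; exact: key.
have g0 : g 0 = 0 by rewrite -(subrr 0) -gB subrr.
have dns x e : 0 < e -> exists v, `|iota v - x| < e.
  move=> e0; have [||z [/= xv [v _ vE]]] := @completion_dense _ _ X (ball x e).
  - by exists x; exact: ballxx.
  - exact: ball_open.
  by exists v; move: xv; rewrite -vE -ball_normE/= distrC.
have hl : linear (h : X -> R^o).
  move=> a x y; apply/eqP; rewrite -subr_eq0 -normr_le0.
  apply/ler_addgt0Pl => e e0; rewrite addr0.
  have a1 : 0 < `|a| + 1 by rewrite ltr_wpDl.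
  pose d := e / (M' * (`|a| + 1) *+ 2).
  have c0 : 0 < M' * (`|a| + 1) *+ 2 by rewrite pmulrn_lgt0// mulr_gt0.
  have [v hv] := dns x d (divr_gt0 e0 c0); have [w hw] := dns y d (divr_gt0 e0 c0).
  have -> : h (a *: x + y) - (a *: (h x : R^o) + h y) =
      (h (a *: x + y) - g (a *: v + w)) + (a * (g v - h x) + (g w - h y)).
    by rewrite g_linear -[a *: (h x : R^o)]/(a * h x) -[a *: (g v : R^o)]/(a * g v); ring.
  have -> : e = M' * (`|a| * d + d) + (`|a| * (M' * d) + M' * d).
    by rewrite /d; field; rewrite (gt_eqF M'0) (gt_eqF a1).
  rewrite (le_trans (ler_normD _ _))// lerD//.
    apply: (le_trans (approx _ _)); rewrite ler_pM2l// linearP/= opprD addrACA.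
    rewrite -scalerBr (le_trans (ler_normD _ _))// normrZ.
    by apply: lerD; [rewrite ler_wpM2l// ltW|exact: ltW].
  rewrite (le_trans (ler_normD _ _))// normrM.
  apply: lerD; rewrite ?ler_wpM2l//;
  by rewrite distrC (le_trans (approx _ _))// ler_pM2l// ltW.
pose H : {linear X -> R^o} :=
  HB.pack (h : X -> R^o) (GRing.isLinear.Build R X R^o *:%R (h : X -> R^o) hl).
have hc : continuous (h : X -> R^o).
  apply: (@bounded_linear_continuous _ _ _ H); apply/linear_boundedP.
  near=> r => x /=.
  have := approx x 0; have i0 : iota 0 = 0 by exact: linear0.
  rewrite g0 i0 sub0r normrN subr0.
  move=> /le_trans; apply; rewrite ler_wpM2r//.
  by near: r; apply: nbhs_pinfty_ge; rewrite num_real.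
have hP : (h : X -> R^o) \in @continuous_functional R X by rewrite inE.
exists (Dual hP) => v /=; apply/eqP.
by have := approx (iota v) v; rewrite subrr normr0 mulr0 normr_le0 subr_eq0.
Unshelve. all: by end_near. Qed.

End extension.

Section branch_functionals.
Variables (kappa : infinite_cardinal) (R : realType).
Variable X : completion (c00 kappa R).

(* The range of [completion_map X] is dense, so the extension is unique and
   [branch_functional] does not depend on the choice made below. *)
Lemma branch_sum_extends (B : branch kappa) :
  exists f : dual X,
    forall x, f (completion_map X x) = node_sum (branch_nodes B) x.
Proof.
apply: (@bounded_functional_extends _ _ X _ 1); first exact: node_sum_linear.
by move=> x; rewrite mul1r; exact: branch_sum_le_norm.
Qed.

Definition branch_functional (B : branch kappa) : dual X :=
  projT1 (cid (branch_sum_extends B)).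

Lemma branch_functionalE (B : branch kappa) x :
  branch_functional B (completion_map X x) = node_sum (branch_nodes B) x.
Proof. exact: (projT2 (cid (branch_sum_extends B))). Qed.

End branch_functionals.

(* Main.v *)
(* Passing to a subsequence, the branches form a comb: the k-th branch leaves
   all the later ones at the level d_k, where d_0 < d_1 < ...  Let s_k be the
   node of level d_(k+1) of the k-th branch.  The s_k are pairwise incomparable
   and s_k lies on no other branch of the comb.  If an admissible family starts
   at the level eta and s_j is the first of these nodes that it meets, then
   eta <= d_(j+1), and all s_k with k > j have the same predecessor at the level
   eta; hence, besides the segment through s_j, at most one member of the family
   meets the s_k.  So the combinations of the s_k with signs as coefficients have
   norm at most 2, and they witness the lower l1-estimate. *)
Require Import Defs.
From mathcomp Require Import all_boot all_order all_algebra.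
From mathcomp Require Import all_classical all_reals topology normedtype.

Set Implicit Arguments.
Unset Strict Implicit.
Unset Printing Implicit Defensive.

Import Order.TTheory GRing.Theory Num.Theory.
Import numFieldNormedType.Exports.

Local Open Scope classical_set_scope.
Local Open Scope ring_scope.

(** * Extracting a comb from a sequence of distinct branches *)

Section comb.
Variables (kappa : infinite_cardinal) (B : nat -> branch kappa).

(** A node of level [d k] carries only the bits below [d k], so for [k < l] the branches [phi k] and
    [phi l] share exactly their nodes of level at most [d k]. *)
Definition comb (phi : nat -> nat) (d : nat -> kappa) : Prop :=
  [/\ forall k l, (k < l)%N -> (d k < d l)%O,
      forall k l xi, (k <= l)%N -> (xi < d k)%O -> B (phi k) xi = B (phi l) xi &
      forall k l, (k < l)%N -> B (phi k) (d k) <> B (phi l) (d k)].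

(** Take for [d] the least level at which two branches of [A] differ. One of the two bits at [d]
    occurs infinitely often and yields [A']; [n] is an index with the other bit. *)
Lemma infinite_branch_split (A : set nat) :
  (forall n m, n <> m -> B n <> B m) -> infinite_set A ->
  exists n d (A' : set nat),
    [/\ infinite_set A' /\ A' `<=` A, A n, forall m, A' m -> (n < m)%N,
        (forall xi m m', (xi < d)%O -> A m -> A m' -> B m xi = B m' xi) /\
        (exists m m', [/\ A m, A m' & B m d <> B m' d]) &
        forall m, A' m -> B m d = ~~ B n d].
Proof.
move=> Bd iA.
have [d [[m [m' [Am Am' mm']]] dmin]] : exists d,
    least [set d | exists m m', [/\ A m, A m' & B m d <> B m' d]] d.
  apply: least_exists.
  have [m Am] := infinite_setN0 iA.
  have [m' [Am' /nesym/Bd h]] := infinite_setN0 (infinite_setD iA (finite_set1 m)).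
  apply: contrapT => nex; apply: h; apply/funext => d.
  by apply: contrapT => dd; apply: nex; exists d, m, m'.
have [b ib] : exists b, infinite_set (A `&` [set p | B p d = b]).
  apply: contrapT => /forallNP h.
  have /contrapT h1 := h true; have /contrapT h2 := h false.
  apply: iA; apply: (@sub_finite_set _ _
    ((A `&` [set p | B p d = true]) `|` (A `&` [set p | B p d = false]))).
    by move=> p Ap; case e : (B p d); [left|right].
  by rewrite finite_setU.
have [n [An nb]] : exists n, A n /\ b = ~~ B n d.
  have [mb|mb] := eqVneq (B m d) b; [exists m'|exists m]; split => //.
    by move: mm'; rewrite mb; case: (B m' d) (b) => -[].
  by case: (B m d) (b) mb => -[].
(* Discarding the indices up to [n] is what later makes [phi] strictly increasing. *)
exists n, d, ((A `&` [set p | B p d = b]) `\` `I_n.+1); split => //.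
- split; last by move=> p [[]].
  exact: infinite_setD ib (finite_II _).
- by move=> p [_ /negP]; rewrite -leqNgt.
- split; last by exists m, m'.
  move=> xi p p' xid Ap Ap'; apply: contrapT => pp'.
  have : (d <= xi)%O by apply: dmin; exists p, p'.
  by rewrite leNgt xid.
- by move=> p [[_ /= ->]].
Qed.

(** The splitting is iterated from the set of all indices; [phi k] and [d k] come from the [k]-th
    set, and all later choices stay in the next one. *)
Lemma comb_subsequence : (forall n m, n <> m -> B n <> B m) ->
  exists phi d, {homo phi : n m / (n < m)%N} /\ comb phi d.
Proof.
move=> Bd; pose S := {A : set nat | infinite_set A}.
have /choice[f fP] : forall A : S, exists u : nat * kappa * S,
    [/\ sval u.2 `<=` sval A, sval A u.1.1, forall m, sval u.2 m -> (u.1.1 < m)%N,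
        (forall xi m m', (xi < u.1.2)%O -> sval A m -> sval A m' ->
           B m xi = B m' xi) /\
        (exists m m', [/\ sval A m, sval A m' & B m u.1.2 <> B m' u.1.2]) &
        forall m, sval u.2 m -> B m u.1.2 = ~~ B u.1.1 u.1.2].
  move=> [A iA]; have [n [d [A' [[iA' A'A] An nA' ds sp]]]] := infinite_branch_split Bd iA.
  by exists (n, d, exist _ A' iA').
have {f fP}[A [phi [d AP]]] : exists (A : nat -> set nat) (phi : nat -> nat)
    (d : nat -> kappa), forall k,
    [/\ A k.+1 `<=` A k, A k (phi k), forall m, A k.+1 m -> (phi k < m)%N,
        (forall xi m m', (xi < d k)%O -> A k m -> A k m' -> B m xi = B m' xi) /\
        (exists m m', [/\ A k m, A k m' & B m (d k) <> B m' (d k)]) &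
        forall m, A k.+1 m -> B m (d k) = ~~ B (phi k) (d k)].
  pose F k := iter k (fun a => (f a).2) (exist _ setT infinite_nat : S).
  exists (fun k => sval (F k)), (fun k => (f (F k)).1.1), (fun k => (f (F k)).1.2).
  by move=> k; exact: fP (F k).
have AS k l : (k <= l)%N -> A l `<=` A k.
  move=> /subnK <-; elim: (l - k)%N => // i IH.
  by apply: subset_trans IH; rewrite addSn; case: (AP (i + k)%N).
have Aphi k l : (k <= l)%N -> A k (phi l).
  by move=> kl; apply: (AS _ _ kl); case: (AP l).
have split_ k m : A k.+1 m -> B m (d k) = ~~ B (phi k) (d k).
  by case: (AP k) => _ _ _ _; apply.
have agree k xi m m' : (xi < d k)%O -> A k m -> A k m' -> B m xi = B m' xi.
  by case: (AP k) => _ _ _ [+ _] _; apply.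
exists phi, d; split.
  by move=> k l kl; have [_ _ + _ _] := AP k; apply; exact: Aphi kl.
split.
(* If [d l <= d k], two indices of [A l] with different bits at [d l] lie in [A k.+1], whose
   branches agree up to and including [d k]. *)
- move=> k l kl; rewrite ltNge; apply/negP => lk.
  have [_ _ _ [_ [m [m' [Am Am' ne]]]] _] := AP l.
  have [Akm Akm'] := (AS _ _ kl _ Am, AS _ _ kl _ Am').
  apply: ne; move: lk; rewrite le_eqVlt => /predU1P[->|lk].
    by rewrite (split_ _ _ Akm) (split_ _ _ Akm').
  exact: agree lk (AS _ _ (leqnSn k) _ Akm) (AS _ _ (leqnSn k) _ Akm').
- by move=> k l xi kl xid; apply: agree xid _ _; exact: Aphi.
- by move=> k l kl; rewrite (split_ k _ (Aphi _ _ kl)); case: (B _ _).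
Qed.

End comb.

(** * Nodes of a comb and the segments through them *)

Section comb_nodes.
Variables (kappa : infinite_cardinal) (B : nat -> branch kappa).
Variables (phi : nat -> nat) (d : nat -> kappa).
Hypothesis combB : comb B phi d.

(** At level [d k] the node would still lie on all later branches; level [d k.+1] includes the
    separating bit at [d k]. *)
Definition comb_node k : node kappa := branch_node (B (phi k)) (d k.+1).

Let d_lt k l : (k < l)%N -> (d k < d l)%O.
Proof. by have [+ _ _] := combB; apply. Qed.

Let d_le k l : (k <= l)%N -> (d k <= d l)%O.
Proof. by rewrite leq_eqVlt => /predU1P[->//|/d_lt/ltW]. Qed.

Let agree k l xi : (k <= l)%N -> (xi < d k)%O -> B (phi k) xi = B (phi l) xi.
Proof. by have [_ + _] := combB; apply. Qed.

Let differ k l : (k < l)%N -> B (phi k) (d k) <> B (phi l) (d k).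
Proof. by have [_ _] := combB; apply. Qed.

(** For [k <> l] the branches differ at the smaller of [d k] and [d l], which is below [d k.+1] and
    hence recorded in the node. *)
Lemma comb_node_branch k l : branch_nodes (B (phi l)) (comb_node k) <-> k = l.
Proof.
split=> [[e _ ek]|->]; last by exists (d l.+1).
have eE : e = d k.+1 := congr1 (@lev kappa) ek; subst e.
have eqB xi : (xi < d k.+1)%O -> B (phi l) xi = B (phi k) xi.
  move=> h; have [_ /(_ xi h h)] : node_le (branch_node (B (phi l)) (d k.+1)) (comb_node k).
    by rewrite ek; exact: node_le_refl.
  by [].
case: (ltngtP k l) => // kl.
- by case: (differ kl); rewrite eqB// d_lt.
- by case: (differ kl); rewrite eqB// d_lt// ltnW.
Qed.

(** A node below [comb_node l] lies on the branch [phi l], so [comb_node_branch] applies. *)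
Lemma comb_node_incomparable k l : node_le (comb_node k) (comb_node l) -> k = l.
Proof.
move=> [/= dkl h]; apply/comb_node_branch; exists (d k.+1) => //.
have eqB xi : (xi < d k.+1)%O -> B (phi k) xi = B (phi l) xi.
  by move=> xik; exact: (h xi xik (lt_le_trans xik dkl)).
by apply: node_le_anti; split => //= xi xik _; rewrite eqB.
Qed.

Lemma segment_comb_node I k l : segment I -> I (comb_node k) -> I (comb_node l) ->
  k = l.
Proof.
move=> [tot _] Ik Il; case: (tot _ _ Ik Il) => /comb_node_incomparable //.
Qed.

Lemma admissible_comb_node r (I : 'I_r -> set (node kappa)) j k l p q :
  admissible I -> (exists i, I i (comb_node j)) -> (j < k)%N -> (j < l)%N ->
  I p (comb_node k) -> I q (comb_node l) -> p = q.
Proof.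
move=> [tI [eta1 [eta2 [_ sI]]]] [i Ij] jk jl pk ql.
have eta1j : (eta1 <= d j.+1)%O.
  by have [_ _ [_ lb] _] := sI i; apply: lb; exists (comb_node j).
(* Each segment attains its least level [eta1] at a node [t] below its comb node; as
   [eta1 <= d j.+1], all branches [phi m] with [m > j] give the same [t]. *)
have restr m u : (j < m)%N -> I u (comb_node m) ->
    I u (branch_node (B (phi j.+1)) eta1).
  move=> jm um; have [[tot _] _ [[t ut tE] _] _] := sI u.
  suff <- : t = branch_node (B (phi j.+1)) eta1 by [].
  have tm : (lev t <= d m.+1)%O.
    by rewrite tE (le_trans eta1j)// d_le// ltnW.
  have {}tm : node_le t (comb_node m).
    case: (tot _ _ ut um) => // mt.
    by apply: node_le_restr (node_le_refl t) mt tm.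
  apply: node_le_anti; split => /=; rewrite ?tE// => xi h1 h2.
    have [lem /(_ xi h1 (lt_le_trans h1 lem)) ->] := tm.
    by rewrite /= (agree jm)// (lt_le_trans h2).
  have [lem /(_ xi h2 (lt_le_trans h2 lem)) ->] := tm.
  by rewrite /= (agree jm)// (lt_le_trans h1).
apply: tI => //; exists (branch_node (B (phi j.+1)) eta1).
by split; [exact: restr jk pk|exact: restr jl ql].
Qed.

End comb_nodes.

(** * Unit vectors and their sums over sets of nodes *)

Section unit_vectors.
Variables (kappa : infinite_cardinal) (R : realType).

Lemma unit_vector_finitely_supported (s : node kappa) :
  (fun t => (t == s)%:R : R^o) \in @finitely_supported kappa R.
Proof.
rewrite inE; apply: sub_finite_set (finite_set1 s) => t /=.
by case: (t =P s) => // _; rewrite eqxx.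
Qed.

Definition unit_vector s : c00 kappa R := C00 (unit_vector_finitely_supported s).

Lemma node_sum_unit_vector I s : node_sum I (unit_vector s) = (s \in I)%:R.
Proof.
rewrite (@node_sumE _ _ I _ [:: s])//; last first.
  by move=> t; rewrite inE /= => /negbTE ->.
by rewrite big_mkcond big_seq1/= eqxx; case: (s \in I).
Qed.

Lemma node_sum_comb I n (e : 'I_n -> R) (s : 'I_n -> node kappa) :
  node_sum I (\sum_(k < n) e k *: unit_vector (s k)) =
  \sum_(k < n) e k * (s k \in I)%:R.
Proof.
rewrite (big_morph _ (@node_sumD kappa R I) (_ : _ = 0)).
  by apply: eq_bigr => k _; rewrite node_sumZ node_sum_unit_vector.
by have := node_sumZ I 0 (0 : c00 kappa R); rewrite scale0r mul0r.
Qed.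

End unit_vectors.

(** * Norm of combinations of comb nodes *)

Section comb_norm.
Variables (kappa : infinite_cardinal) (R : realType) (B : nat -> branch kappa).
Variables (phi : nat -> nat) (d : nat -> kappa).
Hypothesis combB : comb B phi d.

(** A segment contains at most one comb node, so it adds at most 1 to the sum of squares, and at
    most two segments contribute. The resulting bound, the square root of 2, is relaxed to 2. *)
Lemma comb_norm n (e : 'I_n -> R) : (forall k, `|e k| <= 1) ->
  `|\sum_(k < n) e k *: unit_vector R (comb_node B phi d k)| <= 2.
Proof.
move=> e1; set x := \sum_(k < n) _; apply: tree_norm_le => r I aI.
have [_ [eta1 [eta2 [_ sI]]]] := aI.
pose meets p k := I p (comb_node B phi d (k : 'I_n)).
have sum1 p : `|node_sum (I p) x| ^+ 2 <= 1.
  rewrite expr_le1//.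
  rewrite node_sum_comb; have [[k pk]|np] := pselect (exists k, meets p k); last first.
    rewrite big1 ?normr0// => k _; case: (asboolP (meets p k)) => pk.
      by case: np; exists k.
    by rewrite memNset// mulr0.
  rewrite (bigD1 k)//= big1 ?addr0; last first.
    move=> l lk; rewrite memNset ?mulr0// => pl.
    have [sg _ _ _] := sI p.
    by move/eqP: lk; apply; apply/val_inj; exact: (segment_comb_node combB sg pl pk).
  by rewrite normrM normr_nat (mem_set (pk : I p _)) mulr1.
have sum0 p : ~ (exists k, meets p k) -> `|node_sum (I p) x| ^+ 2 = 0.
  move=> np; rewrite node_sum_comb big1 ?normr0 ?expr0n// => k _.
  by rewrite memNset ?mulr0// => pk; apply: np; exists k.
suff : \sum_(p < r) `|node_sum (I p) x| ^+ 2 <= 2.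
  move=> h; apply: le_trans (ler_wsqrtr h) _.
  rewrite -[leRHS]ger0_norm// -sqrtr_sqr ler_wsqrtr// expr2.
  by rewrite -[leLHS]mulr1 ler_pM2l// ler1n.
have [[p0 [k0 pk0]]|none] := pselect (exists p k, meets p k); last first.
  by rewrite big1 // => p _; apply: sum0 => -[k pk]; apply: none; exists p, k.
(* [j] is the least index of a comb node met by the family, and [p] a member through that node. *)
have /ex_minnP[j /asboolP[p [k [pk kj]]] jmin] :
    exists j, `[< exists p k, meets p k /\ k = j :> nat >].
  by exists k0; apply/asboolP; exists p0, k0.
(* Equality of indices would put the same comb node into two disjoint members. *)
have later q l : q != p -> meets q l -> (j < l)%N.
  move=> qp ql; rewrite ltn_neqAle jmin ?andbT; last by apply/asboolP; exists q, l.
  apply/eqP => jl; have kl : k = l by apply/val_inj; exact: etrans kj jl.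
  move/eqP: qp; apply; have [tI _] := aI; apply: tI => //.
  by exists (comb_node B phi d k); split => //; rewrite kl.
have first_met : exists i, I i (comb_node B phi d j) by exists p; rewrite -kj.
rewrite (bigD1 p)//= (_ : 2 = 1 + 1)//; apply: lerD => //.
have [[q [qp [l ql]]]|none] := pselect (exists q, q != p /\ exists l, meets q l).
  rewrite (bigD1 q)//= big1 ?addr0// => q' /andP[q'p q'q]; apply: sum0 => -[l' q'l'].
  move/eqP: q'q; apply.
  exact: (admissible_comb_node combB aI first_met (later _ _ q'p q'l')
    (later _ _ qp ql) q'l' ql).
by rewrite big1// => q qp; apply: sum0 => qk; apply: none; exists q.
Qed.

End comb_norm.

(** * Evaluation and norm of functionals *)

Section dual_facts.
Variables (kappa : infinite_cardinal) (R : realType).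
Variable X : completion (c00 kappa R).

Lemma dual_sumE (V : normedModType R) n (a : 'I_n -> R) (f : 'I_n -> dual V) x :
  (\sum_(i < n) a i *: f i) x = \sum_(i < n) a i * f i x :> R.
Proof. by elim/big_rec2: _ => // i _ g _ <-. Qed.

(** The bound holds on the dense image of [c00] by [branch_sum_le_norm], and boundedness of [f]
    carries it over to [X]. *)
Lemma branch_functional_norm (b : branch kappa) : `|branch_functional X b| <= 1.
Proof.
set f := branch_functional X b; apply: dual_norm_le => x x1.
apply/ler_addgt0Pr => e e0.
have c0 : 0 < 1 + `|f| by rewrite ltr_wpDr.
(* The radius absorbs two errors: [|x - y|] from passing between the norms of [y] and [x], and
   [|f| * |x - y|] from [f (x - y)]. *)
have [||z [/= xz [v _ vz]]] := @completion_dense _ _ X (ball x (e / (1 + `|f|))).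
- by exists x; apply: ballxx; rewrite divr_gt0.
- exact: ball_open.
move: xz; rewrite -vz -ball_normE/= => xv; set y := completion_map X v in xv.
have -> : f x = f y + f (x - y) :> R.
  by rewrite -[RHS]/(f y + f (x - y)) -linearD addrC subrK.
have fy : `|f y : R| <= `|y|.
  by rewrite branch_functionalE completion_isometry branch_sum_le_norm.
apply: le_trans (ler_normD _ _) _.
apply: le_trans (lerD fy (dual_norm_ge f (x - y))) _.
have yx : `|y| <= `|x| + `|x - y|.
  by rewrite -{1}(subKr x y) (le_trans (ler_normB _ _)).
apply: le_trans (lerD yx (lexx _)) _.
rewrite -addrA lerD// -{1}[`|x - y|]mul1r -mulrDl mulrC.
by rewrite -ler_pdivlMr// ltW.
Qed.

End dual_facts.

Theorem theorem3p1 (R : realType) (kappa : infinite_cardinal)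
    (X : completion (c00 kappa R)) (B : nat -> branch kappa)
    (B_distinct : forall n m : nat, n <> m -> B n <> B m) :
  exists phi : nat -> nat,
    (forall n m : nat, (n < m)%N -> (phi n < phi m)%N) /\
    l1_basis_equivalent (fun k : nat => branch_functional X (B (phi k))).
Proof.
have [phi [d [phi_lt combB]]] := comb_subsequence B_distinct.
exists phi; split; first exact: phi_lt.
(* The constant 1 bounds each functional; [2^-1] is the inverse of the norm bound for the test
   vector [x]. *)
exists 2^-1, 1; split; rewrite ?invr_gt0// => n a; split; last first.
  rewrite mul1r (le_trans (ler_norm_sum _ _ _))// ler_sum// => i _.
  by rewrite normrZ ler_piMr// branch_functional_norm.
set f : dual X := \sum_(i < n) a i *: _.
(* Only the [k]-th comb node lies on the [k]-th branch, so the signs turn [f] at [x] into the sum of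
   the [|a k|]. A zero coefficient has sign 0, whence the bound rather than equality on the
   coefficients in [comb_norm]. *)
pose x := \sum_(k < n) Num.sg (a k) *: unit_vector R (comb_node B phi d k).
have x2 : `|completion_map X x| <= 2.
  rewrite completion_isometry; apply: comb_norm => // k.
  by rewrite normr_sg lern1 leq_b1.
have fx : f (completion_map X x) = \sum_(i < n) `|a i| :> R.
  rewrite dual_sumE; apply: eq_bigr => i _.
  rewrite branch_functionalE node_sum_comb (bigD1 i)//= big1 ?addr0.
    rewrite mem_set; last exact/(comb_node_branch combB).
    by rewrite mulr1 mulrC -normrEsg.
  move=> k ki; rewrite memNset ?mulr0// => /(comb_node_branch combB)/val_inj.
  exact/eqP.
have := dual_norm_ge f (completion_map X x).
rewrite fx ger0_norm ?sumr_ge0// => h.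
rewrite ler_pdivrMl// mulrC (le_trans h)// ler_wpM2l//.
exact: dual_norm_ge0.
Qed.
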